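(* Let $m$ be a nonnegative integer and $0<q<1$. Then $$\prod_{j=1}^\infty(1-q^j)^{m+1}=\sum_{n=0}^\infty(-1)^nq^{n(n-1)/2}(1-q^{2n+1})\;{}_{m+2}\phi_{m+1}\left({q^{-n},q^{n+1},q,\dots,q\atop 0,0,\dots,0};q,q\right),$$ where in the ${}_{m+2}\phi_{m+1}$ the upper parameters are $q^{-n},q^{n+1}$ followed by $m$ copies of $q$, and the lower parameters are $m+1$ copies of $0$.
   Context: Put $(x;q)_0=1$, $(x;q)_k=\prod_{i=0}^{k-1}(1-xq^i)$. For a nonnegative integer $n$, the terminating basic hypergeometric series is $${}_{r+1}\phi_r\left({q^{-n},a_2,\dots,a_{r+1}\atop b_1,\dots,b_r};q,z\right)=\sum_{k=0}^n\frac{(q^{-n};q)_k(a_2;q)_k\cdots(a_{r+1};q)_k}{(q;q)_k(b_1;q)_k\cdots(b_r;q)_k}z^k .$$ *)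

(* Defs.v *)
From HB Require Import structures.
From mathcomp Require Import all_boot all_order all_algebra.
From mathcomp Require Import all_classical all_reals all_analysis.

Set Implicit Arguments.
Unset Strict Implicit.
Unset Printing Implicit Defensive.

Import Order.TTheory GRing.Theory Num.Theory.
Import numFieldNormedType.Exports.

Local Open Scope classical_set_scope.
Local Open Scope ring_scope.

Definition qpoch (R : comPzRingType) (x q : R) (k : nat) : R :=
  \prod_(i < k) (1 - x * q ^+ i).

(* The upper parameters are q^-n followed by a = (a_2, ..., a_(r+1)); the
   factor (q^-n; q)_k vanishes for k > n, so the sum stops at k = n. *)
Definition qhyper (R : fieldType) (n r : nat) (a b : r.-tuple R) (q z : R) : R :=
  \sum_(k < n.+1)
    (qpoch (q ^- n) q k * \prod_(i < r) qpoch (tnth a i) q k)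
    / (qpoch q q k * \prod_(i < r) qpoch (tnth b i) q k) * z ^+ k.

(* Main.v *)
Require Import Defs.
From HB Require Import structures.
From mathcomp Require Import all_boot all_order all_algebra.
From mathcomp Require Import all_classical all_reals all_analysis.
From mathcomp Require Import ring lra zify.

Set Implicit Arguments.
Unset Strict Implicit.
Unset Printing Implicit Defensive.

Import Order.TTheory GRing.Theory Num.Theory.
Import numFieldNormedType.Exports.

Local Open Scope classical_set_scope.
Local Open Scope ring_scope.

(** Write p_n for (q;q)_n.  The double series in n and k does not converge
    absolutely: its terms with n - k fixed do not tend to 0, and summing over n
    first gives 0 for every k.  So the summations are exchanged in the partial
    sums only, where for fixed k the terms in n telescope.  Indeed
    (q^-n;q)_k (q^(n+1);q)_k equals, up to a sign and a power of q,
    p_(n+k) / p_(n-k) ([phi_summand]), and the factor 1 - q^(2n+1) splits as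
    (1 - q^(n-k)) + q^(n-k) (1 - q^(n+k+1)), which makes each term a difference
    ([telescope_step]).  So the N-th partial sum is a single finite sum, which
    with j = N - k reads

      S_N = sum_(j <= N) (-1)^j q^(j(j+1)/2) / (p_j p_(N-j))
                         * p_(N-j)^m p_(2N-j+1)          ([partial_sumE]).

    For fixed j the last factors tend to the (m+1)-st power of the infinite
    product, and what is left is Euler's expansion of (q;q)_oo.  The passage to
    the limit can be made with an explicit rate: the finite q-binomial theorem
    ([q_binomial], at x = q) gives

      p_N^(m+1) = sum_(j <= N) (-1)^j q^(j(j+1)/2) / (p_j p_(N-j)) * p_N^(m+1)

    with the same coefficients, so that S_N - p_N^(m+1) is controlled by the
    differences p_(N-j) - p_N and p_(2N-j+1) - p_N, both O(q^(N-j)).  The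
    Gaussian decay q^(j(j+1)/2) absorbs the loss q^(-j), and
    S_N - p_N^(m+1) = O(q^N) ([partial_sum_error]).  The products p_n are
    bounded away from 0 ([qpoch_lbound]), so the division by them is harmless,
    including for m = 0. *)

(** * The q-shifted factorial *)

Lemma qpoch0 (R : comPzRingType) (x q : R) : qpoch x q 0 = 1.
Proof. by rewrite /qpoch big_ord0. Qed.

Lemma qpochS (R : comPzRingType) (x q : R) k :
  qpoch x q k.+1 = qpoch x q k * (1 - x * q ^+ k).
Proof. by rewrite /qpoch big_ord_recr. Qed.

Lemma qpochSl (R : comPzRingType) (x q : R) k :
  qpoch x q k.+1 = (1 - x) * qpoch (x * q) q k.
Proof.
rewrite /qpoch big_ord_recl expr0 mulr1; congr (_ * _).
by apply: eq_bigr => i _; rewrite lift0 exprS mulrA.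
Qed.

Lemma qpochD (R : comPzRingType) (x q : R) n k :
  qpoch x q (n + k) = qpoch x q n * qpoch (x * q ^+ n) q k.
Proof.
elim: k => [|k IH]; first by rewrite addn0 qpoch0 mulr1.
by rewrite addnS !qpochS IH exprD !mulrA.
Qed.

Lemma qpoch0l (R : comPzRingType) (q : R) k : qpoch 0 q k = 1.
Proof. by rewrite /qpoch big1 // => i _; rewrite mul0r subr0. Qed.

Lemma qpochqS (R : comPzRingType) (q : R) k :
  qpoch q q k.+1 = qpoch q q k * (1 - q ^+ k.+1).
Proof. by rewrite qpochS exprS. Qed.

(** * The finite q-binomial theorem *)

(** Keeping the factorials as 1 / (p_j p_(N-j)) instead of forming Gaussian
    binomials avoids a separate Pascal rule: the recurrence in N comes from
    splitting 1 - q^(N+1) = (1 - q^(N+1-j)) + q^(N+1-j) (1 - q^j), where each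
    part cancels the last factor of one of the two factorials. *)
Lemma q_binomial (F : fieldType) (x q : F) (N : nat) :
  (forall n, qpoch q q n != 0) ->
  \sum_(j < N.+1) (-1) ^+ j * q ^+ 'C(j, 2) * x ^+ j
      / (qpoch q q j * qpoch q q (N - j))
  = qpoch x q N / qpoch q q N.
Proof.
move=> p_neq0.
have f_neq0 n : 1 - q ^+ n.+1 != 0.
  by have := p_neq0 n.+1; rewrite qpochqS mulf_eq0 negb_or => /andP[].
elim: N => [|N IH].
  by rewrite big_ord_recl big_ord0 /= !qpoch0 !expr0 !mul1r addr0.
apply: (mulfI (f_neq0 N)).
have -> : (1 - q ^+ N.+1) * (qpoch x q N.+1 / qpoch q q N.+1)
    = (1 - x * q ^+ N) * (qpoch x q N / qpoch q q N).
  rewrite qpochqS qpochS; field.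
  by rewrite p_neq0 f_neq0.
rewrite -IH.
pose t j : F := (-1) ^+ j * q ^+ 'C(j, 2) * x ^+ j
      / (qpoch q q j * qpoch q q (N.+1 - j)).
transitivity (\sum_(j < N.+2) t j * (1 - q ^+ (N.+1 - j))
   + \sum_(j < N.+2) t j * (q ^+ (N.+1 - j) * (1 - q ^+ j))).
  rewrite -big_split mulr_sumr; apply: eq_bigr => j _; rewrite /= -/(t j).
  have -> : q ^+ N.+1 = q ^+ (N.+1 - j) * q ^+ j.
    by rewrite -exprD subnK // -ltnS.
  by ring.
(* The first part vanishes at j = N + 1 and the second one at j = 0. *)
rewrite big_ord_recr /= subnn expr0 subrr mulr0 addr0.
rewrite [X in _ + X]big_ord_recl /= expr0 subrr !mulr0 add0r.
rewrite mulrBl mul1r mulr_sumr -sumrN; congr (_ + _); apply: eq_bigr => j _.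
- rewrite /t subSn; last by rewrite -ltnS.
  rewrite qpochqS; field.
  by rewrite !p_neq0 f_neq0.
- rewrite /t /bump add1n subSS binS bin1 exprD qpochqS !exprS.
  have -> : q ^+ N = q ^+ (N - j) * q ^+ j.
    by rewrite -exprD subnK // -ltnS.
  field.
  by rewrite !p_neq0 -exprS f_neq0.
Qed.

(** * Telescoping the partial sums *)

(** Each factor is turned over: 1 - q^-i = - q^-i (1 - q^i) for d < i <= k + d,
    and these i add up to C(k + d, 2) + k - C(d, 2). *)
Lemma qpoch_expV (F : fieldType) (q : F) (k d : nat) :
  q != 0 ->
  q ^+ ('C(k + d, 2) + k) * qpoch (q ^- (k + d)) q k * qpoch q q d
  = (-1) ^+ k * q ^+ 'C(d, 2) * qpoch q q (k + d).
Proof.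
move=> q_neq0; elim: k => [|k IH].
  by rewrite !add0n addn0 qpoch0 expr0 !mulr1 mul1r.
rewrite addSn qpochSl qpochqS.
have -> : q ^- (k + d).+1 * q = q ^- (k + d).
  by rewrite exprS invfM mulrAC mulVf // mul1r.
transitivity ((q ^+ (k + d).+1 * (1 - q ^- (k + d).+1)) *
   (q ^+ ('C(k + d, 2) + k) * qpoch (q ^- (k + d)) q k * qpoch q q d)).
  rewrite binS bin1 !(exprD, exprS); ring.
rewrite IH mulrBr mulr1 divff ?expf_neq0 // !exprS; ring.
Qed.

(** The products (q^-n;q)_k and (q^(n+1);q)_k are, up to a sign and a power of
    q, the quotients p_n / p_(n-k) and p_(n+k) / p_n, and the exponents
    C(n, 2) + (C(k, 2) - nk) + k add up to C(n - k, 2). *)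
Lemma phi_summand (F : fieldType) (q : F) (n k : nat) :
  q != 0 -> (forall i, qpoch q q i != 0) -> (k <= n)%N ->
  (-1) ^+ n * q ^+ 'C(n, 2) * (qpoch (q ^- n) q k * qpoch (q ^+ n.+1) q k)
    * q ^+ k
  = (-1) ^+ (n - k) * q ^+ 'C(n - k, 2) * qpoch q q (n + k)
    / qpoch q q (n - k).
Proof.
move=> q_neq0 p_neq0 le_kn; set d := (n - k)%N.
have nE : n = (k + d)%N by rewrite subnKC.
apply: (mulIf (p_neq0 d)); rewrite divfK //.
have := qpoch_expV k d q_neq0; rewrite -nE exprD => H.
have -> : (-1) ^+ n = (-1) ^+ k * (-1) ^+ d :> F by rewrite nE exprD.
rewrite qpochD -exprS.
transitivity ((-1) ^+ k * (-1) ^+ d * qpoch (q ^+ n.+1) q k *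
  (q ^+ 'C(n, 2) * q ^+ k * qpoch (q ^- n) q k * qpoch q q d)); first by ring.
rewrite H.
have sign_sqr : (-1) ^+ k * (-1) ^+ k = 1 :> F by rewrite -expr2 sqrr_sign.
transitivity (((-1) ^+ k * (-1) ^+ k) * ((-1) ^+ d * qpoch (q ^+ n.+1) q k *
   (q ^+ 'C(d, 2) * qpoch q q n))); first by ring.
by rewrite sign_sqr; ring.
Qed.

(** The identity behind the telescoping, with d = N - k:
    (1 - q^(d+1)) + q^(d+1) (1 - q^(N+k+2)) = 1 - q^(2N+3). *)
Lemma telescope_step (F : fieldType) (q : F) (N k : nat) :
  (forall i, qpoch q q i != 0) -> (k <= N)%N ->
  (-1) ^+ (N - k) * q ^+ 'C((N - k).+1, 2) * qpoch q q (N + k).+1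
      / qpoch q q (N - k)
  + (-1) ^+ (N.+1 - k) * q ^+ 'C(N.+1 - k, 2) * qpoch q q (N.+1 + k)
      / qpoch q q (N.+1 - k) * (1 - q ^+ (2 * N.+1 + 1))
  = (-1) ^+ (N.+1 - k) * q ^+ 'C((N.+1 - k).+1, 2) * qpoch q q (N.+1 + k).+1
      / qpoch q q (N.+1 - k).
Proof.
move=> p_neq0 le_kN; rewrite subSn // addSn; set d := (N - k)%N.
have -> : (2 * N.+1 + 1 = d.+1 + (N + k).+2)%N by rewrite /d; lia.
have f_neq0 : 1 - q ^+ d.+1 != 0.
  by have := p_neq0 d.+1; rewrite qpochqS mulf_eq0 negb_or => /andP[].
rewrite (qpochqS q (N + k).+1) (qpochqS q d) (binS d.+1 1) bin1.
rewrite (exprS (-1) d) !exprD.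
by field; rewrite p_neq0 f_neq0.
Qed.

(** Column k of the triangle starts at n = k, where v plays the role of the
    first term of the column, and each further term of the column is an
    increment of v; summing the rows and summing the columns agree without a
    separate exchange of summations. *)
Lemma triangular_telescope (V : nmodType) (u v : nat -> nat -> V) (N : nat) :
  (forall n, u n n = v n n) ->
  (forall n k, (k <= n)%N -> v n k + u n.+1 k = v n.+1 k) ->
  \sum_(n < N.+1) \sum_(k < n.+1) u n k = \sum_(k < N.+1) v N k.
Proof.
move=> diag step; elim: N => [|N IH]; first by rewrite !big_ord1 diag.
rewrite big_ord_recr IH /= !(big_ord_recr N.+1) /= addrA -big_split /= diag.
by congr (_ + _); apply: eq_bigr => k _; rewrite step // -ltnS.
Qed.

Lemma qhyperE (F : fieldType) (q : F) (n m : nat) :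
  (forall i, qpoch q q i != 0) ->
  qhyper n [tuple of q ^+ n.+1 :: nseq m q] [tuple of nseq m.+1 0] q q
  = \sum_(k < n.+1) qpoch q q k ^+ m / qpoch q q k
      * (qpoch (q ^- n) q k * qpoch (q ^+ n.+1) q k * q ^+ k).
Proof.
move=> p_neq0; apply: eq_bigr => k _.
rewrite big_ord_recl (tnth_nth 0) /=.
rewrite (eq_bigr (fun=> qpoch q q k)); last first.
  by move=> i _; rewrite (tnth_nth 0) /= nth_nseq ltn_ord.
rewrite prodr_const card_ord.
rewrite big1; last first.
  move=> i _; rewrite (tnth_nth 0) -[tval _]/(nseq m.+1 0).
  by rewrite nth_nseq ltn_ord qpoch0l.
by rewrite mulr1; field.
Qed.

(** The summation index on the right is j = N - k, where k is the index of the
    hypergeometric sum. *)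
Lemma partial_sumE (F : fieldType) (q : F) (m N : nat) :
  q != 0 -> (forall i, qpoch q q i != 0) ->
  \sum_(n < N.+1) (-1) ^+ n * q ^+ (n * (n - 1))./2 * (1 - q ^+ (2 * n + 1)) *
    qhyper n [tuple of q ^+ n.+1 :: nseq m q] [tuple of nseq m.+1 0] q q
  = \sum_(j < N.+1) (-1) ^+ j * q ^+ 'C(j, 2) * q ^+ j
      / (qpoch q q j * qpoch q q (N - j))
      * (qpoch q q (N - j) ^+ m * qpoch q q (N + (N - j)).+1).
Proof.
move=> q_neq0 p_neq0.
pose w k := qpoch q q k ^+ m / qpoch q q k.
pose u n k := w k * ((-1) ^+ (n - k) * q ^+ 'C(n - k, 2) * qpoch q q (n + k)
  / qpoch q q (n - k) * (1 - q ^+ (2 * n + 1))).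
pose v n k := w k * ((-1) ^+ (n - k) * q ^+ 'C((n - k).+1, 2)
  * qpoch q q (n + k).+1 / qpoch q q (n - k)).
transitivity (\sum_(n < N.+1) \sum_(k < n.+1) u n k).
  apply: eq_bigr => n _; rewrite qhyperE // mulr_sumr; apply: eq_bigr => k _.
  have le_kn : (k <= n)%N by rewrite -ltnS.
  by rewrite /u -(phi_summand q_neq0 p_neq0 le_kn) subn1 -bin2 -/(w k); ring.
have diag n : u n n = v n n.
  rewrite /u /v subnn qpoch0 qpochqS invr1 !mulr1 !expr0 !mul1r.
  by rewrite mul2n addnn addn1.
have step n k : (k <= n)%N -> v n k + u n.+1 k = v n.+1 k.
  by move=> le_kn; rewrite /v /u -mulrDr telescope_step.
rewrite (triangular_telescope _ diag step).
rewrite (reindex_inj rev_ord_inj) /=; apply: eq_bigr => j _.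
have le_jN : (j <= N)%N by rewrite -ltnS.
rewrite /v /w subSS (subKn le_jN) binS bin1 exprD.
by field; rewrite !p_neq0.
Qed.

(** * Bounds on the partial products *)

Lemma qpoch_gt0 (R : realFieldType) (q : R) n :
  0 < q -> q < 1 -> 0 < qpoch q q n.
Proof.
move=> q0 q1; apply: prodr_gt0 => i _; rewrite -exprS subr_gt0.
by rewrite exprn_ilt1 // ltW.
Qed.

Lemma qpoch_nincr (R : realFieldType) (q : R) a b : 0 < q -> q < 1 ->
  (a <= b)%N -> qpoch q q b <= qpoch q q a.
Proof.
move=> q0 q1 /subnKC <-; elim: (b - a)%N => [|c IH]; first by rewrite addn0.
apply: le_trans IH; rewrite addnS qpochqS ler_piMr ?ltW ?qpoch_gt0 //.
by rewrite ltrBlDr ltrDl exprn_gt0.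
Qed.

Lemma qpoch_le1 (R : realFieldType) (q : R) n :
  0 < q -> q < 1 -> qpoch q q n <= 1.
Proof. by move=> q0 q1; rewrite -(qpoch0 q q) qpoch_nincr. Qed.

(** Weierstrass's inequality prod (1 - t_i) >= 1 - sum t_i for
    t_i = q^i, a < i <= b; it provides both the rate of convergence of the
    products and their lower bound. *)
Lemma qpoch_sub_le (R : realFieldType) (q : R) a b : 0 < q -> q < 1 ->
  (a <= b)%N ->
  qpoch q q a - qpoch q q b <= qpoch q q a * (q ^+ a.+1 / (1 - q)).
Proof.
move=> q0 q1 /subnKC <-; set c := (b - a)%N.
have q1' : 0 < 1 - q by rewrite subr_gt0.
(* The induction needs the exact value of the finite geometric sum. *)
suff : qpoch q q a - qpoch q q (a + c)
    <= qpoch q q a * ((q ^+ a.+1 - q ^+ (a + c).+1) / (1 - q)).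
  move/le_trans; apply; rewrite ler_pM2l ?qpoch_gt0 // ler_pM2r ?invr_gt0 //.
  by rewrite gerBl exprn_ge0 // ltW.
elim: c => [|c IH]; first by rewrite addn0 !subrr mul0r mulr0.
have -> : (q ^+ a.+1 - q ^+ (a + c.+1).+1) / (1 - q)
    = (q ^+ a.+1 - q ^+ (a + c).+1) / (1 - q) + q ^+ (a + c).+1.
  rewrite addnS (exprS q (a + c).+1); field.
  by rewrite gt_eqF.
rewrite addnS qpochqS mulrBr mulr1 opprB addrCA [leLHS]addrC mulrDr lerD //.
by rewrite ler_pM2r ?exprn_gt0 // qpoch_nincr // leq_addr.
Qed.

(** Once the tail of the geometric series is below 1/2, the product loses at
    most half of its value. *)
Lemma qpoch_lbound (R : archiRealFieldType) (q : R) : 0 < q -> q < 1 ->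
  exists2 delta, 0 < delta & forall n, delta <= qpoch q q n.
Proof.
move=> q0 q1.
have q1' : 0 < 1 - q by rewrite subr_gt0.
have nq1 : `|q| < 1 by rewrite ger0_norm // ltW.
have half_gt0 : 0 < (1 - q) / 2 by rewrite divr_gt0.
have [n _ /(_ n (leqnn n)) /= qn] := cvgr_lt _ (cvg_expr nq1) _ half_gt0.
exists (qpoch q q n / 2) => [|k]; first by rewrite divr_gt0 ?qpoch_gt0.
have [le_nk|/ltnW le_kn] := leqP n k; last first.
  apply: le_trans (qpoch_nincr q0 q1 le_kn).
  by have := qpoch_gt0 n q0 q1; lra.
have := qpoch_sub_le q0 q1 le_nk.
have : q ^+ n.+1 / (1 - q) <= 1 / 2.
  rewrite ler_pdivrMr // exprS.
  have : q * q ^+ n <= 1 * q ^+ n by rewrite ler_pM2r ?exprn_gt0 // ltW.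
  lra.
by have := qpoch_gt0 n q0 q1; nra.
Qed.

(** * The rate of convergence *)

(** When the m + 1 factors are replaced by z one at a time, starting with y,
    the other factors are in [0, 1], so each replacement costs at most e. *)
Lemma perturbed_power (R : realDomainType) (m : nat) (x y z e : R) :
  0 <= x <= 1 -> 0 <= z <= 1 -> `|x - z| <= e -> `|y - z| <= e ->
  `|x ^+ m * y - z ^+ m.+1| <= e *+ m.+1.
Proof.
move=> /andP[x0 x1] /andP[z0 z1] xz yz; elim: m => [|m IH].
  by rewrite expr0 mul1r expr1.
have -> : x ^+ m.+1 * y - z ^+ m.+2
    = x * (x ^+ m * y - z ^+ m.+1) + (x - z) * z ^+ m.+1.
  by rewrite !exprS; ring.
have zm1 : `|z ^+ m.+1| <= 1 by rewrite ger0_norm ?exprn_ge0 // exprn_ile1.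
rewrite mulrSr; apply: le_trans (ler_normD _ _) _; rewrite !normrM lerD //.
- by rewrite -[leRHS]mul1r ler_pM // ger0_norm.
- by rewrite -[leRHS]mulr1 ler_pM.
Qed.

(** The sum is compared term by term with the q-binomial expansion of p_N,
    which has the same coefficients. *)
Lemma partial_sum_error (R : realType) (q delta : R) (m N : nat) :
  0 < q -> q < 1 -> 0 < delta -> (forall n, delta <= qpoch q q n) ->
  `|\sum_(j < N.+1) (-1) ^+ j * q ^+ 'C(j, 2) * q ^+ j
      / (qpoch q q j * qpoch q q (N - j))
      * (qpoch q q (N - j) ^+ m * qpoch q q (N + (N - j)).+1)
    - qpoch q q N ^+ m.+1|
  <= m.+1%:R / (delta ^+ 2 * (1 - q) ^+ 2) * q ^+ N.
Proof.
move=> q0 q1 d0 dp.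
have q1' : 0 < 1 - q by rewrite subr_gt0.
have p_gt0 n := qpoch_gt0 n q0 q1.
have p_neq0 n : qpoch q q n != 0 by rewrite gt_eqF.
have p01 n : 0 <= qpoch q q n <= 1 by rewrite ltW //= qpoch_le1.
have dist a b : (a <= b)%N ->
    `|qpoch q q b - qpoch q q a| <= q ^+ a.+1 / (1 - q).
  move=> le_ab; rewrite distrC ger0_norm; last by rewrite subr_ge0 qpoch_nincr.
  apply: le_trans (qpoch_sub_le q0 q1 le_ab) _.
  by rewrite ler_piMl ?qpoch_le1 // divr_ge0 ?exprn_ge0 // ltW.
have expN : qpoch q q N ^+ m.+1
    = \sum_(j < N.+1) (-1) ^+ j * q ^+ 'C(j, 2) * q ^+ j
        / (qpoch q q j * qpoch q q (N - j)) * qpoch q q N ^+ m.+1.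
  by rewrite -mulr_suml q_binomial // divff // mul1r.
rewrite [X in _ - X]expN -sumrB.
apply: le_trans (ler_norm_sum _ _ _) _.
apply: (@le_trans _ _ (\sum_(j < N.+1)
    m.+1%:R / (delta ^+ 2 * (1 - q)) * q ^+ N * q ^+ j)); last first.
  have c_ge0 : 0 <= m.+1%:R / (delta ^+ 2 * (1 - q)) * q ^+ N.
    by rewrite mulr_ge0 ?divr_ge0 ?mulr_ge0 ?exprn_ge0 // ltW.
  have nq1 : `|q| < 1 by rewrite ger0_norm // ltW.
  have := geometric_le_lim N.+1 c_ge0 q0 nq1.
  rewrite /series /= big_mkord => /le_trans -> //.
  rewrite le_eqVlt; apply/orP; left; apply/eqP; field.
  by rewrite !gt_eqF.
apply: ler_sum => j _; have le_jN : (j <= N)%N by rewrite -ltnS.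
rewrite -mulrBr normrM.
have brack : `|qpoch q q (N - j) ^+ m * qpoch q q (N + (N - j)).+1
    - qpoch q q N ^+ m.+1| <= q ^+ (N - j).+1 / (1 - q) *+ m.+1.
  apply: perturbed_power => //; first by rewrite distrC dist // leq_subr.
  apply: le_trans (dist N _ _) _; first by rewrite leqW // leq_addr.
  rewrite ler_pM2r ?invr_gt0 // ler_wiXn2l ?ltW //.
  by rewrite ltnS leq_subr.
have coef : `|(-1) ^+ j * q ^+ 'C(j, 2) * q ^+ j
    / (qpoch q q j * qpoch q q (N - j))| <= q ^+ ('C(j, 2) + j) / delta ^+ 2.
  rewrite -mulrA -mulrA normrMsign mulrA -exprD ger0_norm; last first.
    by rewrite divr_ge0 ?mulr_ge0 ?exprn_ge0 // ltW.
  rewrite ler_pM2l ?exprn_gt0 // lef_pV2 ?posrE ?mulr_gt0 ?exprn_gt0 //.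
  by rewrite expr2 ler_pM // ltW.
apply: le_trans (ler_pM (normr_ge0 _) (normr_ge0 _) coef brack) _.
(* The decay of the coefficients beats the loss q^-j of the bracket, and
   leaves a further q^j that makes the sum over j bounded. *)
have expo : q ^+ ('C(j, 2) + j) * q ^+ (N - j).+1 <= q ^+ N * q ^+ j.
  rewrite -!exprD ler_wiXn2l ?ltW //.
  suff : (j <= 'C(j, 2) + 1)%N by lia.
  by case: (nat_of_ord j) => [|[|i]] //; rewrite binS bin1; lia.
have -> : q ^+ ('C(j, 2) + j) / delta ^+ 2 * (q ^+ (N - j).+1 / (1 - q) *+ m.+1)
    = m.+1%:R / (delta ^+ 2 * (1 - q))
      * (q ^+ ('C(j, 2) + j) * q ^+ (N - j).+1).
  rewrite -(mulr_natl _ m.+1); field.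
  by rewrite !gt_eqF.
by rewrite -[leRHS]mulrA ler_wpM2l // divr_ge0 // mulr_ge0 ?exprn_ge0 // ltW.
Qed.

(** * The identity *)

Theorem proposition3p1 (R : realType) (m : nat) (q : R) (q_gt0 : 0 < q) (q_lt1 : q < 1) :
  let pprod := fun N : nat => \prod_(1 <= j < N.+1) (1 - q ^+ j) ^+ m.+1 in
  let term := fun n : nat =>
    (-1) ^+ n * q ^+ (n * (n - 1))./2 * (1 - q ^+ (2 * n + 1)) *
    qhyper n [tuple of q ^+ n.+1 :: nseq m q] [tuple of nseq m.+1 0] q q in
  cvgn pprod /\ series term @ \oo --> limn pprod.
Proof.
move=> pprod term.
have p_neq0 i : qpoch q q i != 0 by rewrite gt_eqF ?qpoch_gt0.
have pprodE N : pprod N = qpoch q q N ^+ m.+1.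
  rewrite /pprod big_add1 /= big_mkord prodrXl; congr (_ ^+ _).
  by apply: eq_bigr => i _; rewrite exprS.
have pprod_cvg : cvgn pprod.
  apply: nonincreasing_is_cvgn.
    move=> a b le_ab; rewrite !pprodE lerXn2r ?nnegrE //.
    - by rewrite ltW ?qpoch_gt0.
    - by rewrite ltW ?qpoch_gt0.
    - exact: qpoch_nincr.
  by exists 0 => _ [N _ <-]; rewrite pprodE exprn_ge0 // ltW ?qpoch_gt0.
split=> //; rewrite -cvg_shiftS /=.
have [delta delta_gt0 delta_le] := qpoch_lbound q_gt0 q_lt1.
pose C := m.+1%:R / (delta ^+ 2 * (1 - q) ^+ 2).
have error N : `|series term N.+1 - pprod N| <= C * q ^+ N.
  rewrite pprodE /series /= big_mkord partial_sumE //; last by rewrite gt_eqF.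
  exact: partial_sum_error.
apply: (@cvg_sub0 _ _ _ _ _ _ pprod) => //; apply/norm_cvg0P.
have geo : (fun N => C * q ^+ N) @ \oo --> 0.
  by apply: cvg_geometric; rewrite ger0_norm // ltW.
apply: (squeeze_cvgr _ (cvg_cst 0) geo).
by near=> N; rewrite normr_ge0 error.
Unshelve. all: by end_near.
Qed.
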